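(* Let $S>1$, $n_1\ge 0$ and $n_2\ge 1$ be integers and consider a partial matrix whose specified entries exhibit an arrowhead structure, i.e. $$\begin{pmatrix}X&Z_1^{\mathsf T}&Z_2^{\mathsf T}&\cdots&Z_S^{\mathsf T}\\Z_1&Y_{1,1}&*&\cdots&*\\Z_2&*&Y_{2,2}&\cdots&*\\ \vdots&\vdots&\vdots&\ddots&\vdots\\Z_S&*&*&\cdots&Y_{S,S}\end{pmatrix},$$ where $X\in\mathcal{S}^{n_1}$, $Y_{i,i}\in\mathcal{S}^{n_2}$, $Z_i\in\mathbb{R}^{n_2\times n_1}$, $i\in[1:S]$, are fully specified and the blocks marked $*$ are entirely unspecified. Let $G_{spec}$ be its specification graph. Then $G_{spec}$ is chordal. If $n_1\in\{0,1\}$, then $G_{spec}$ is also a block-clique graph, which is not the case otherwise (i.e. if $n_1\ge2$, $G_{spec}$ is not a block-clique graph).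
   Context: $\mathcal{S}^m$ is the space of real symmetric $m\times m$ matrices; $[1:S]=\{1,\dots,S\}$. The specification graph of a partial matrix of order $n$ has vertices $v_1,\dots,v_n$, and $\{v_i,v_j\}$ (for $i\neq j$) is an edge if and only if the entry in position $(i,j)$ is specified. A graph is chordal if every cycle of length greater than 3 has a chord (an edge joining two vertices of the cycle that is not an edge of the cycle). A clique is a set of vertices inducing a complete subgraph. A block of a graph is a subgraph that is connected, has no cut vertex (no disconnected subgraph is obtained by removing just one vertex and its adjacent edges from it), and is not contained in any other subgraph with these two properties. A block-clique graph is a graph whose blocks are cliques (complete subgraphs). *)

(* Defs.v *)
From HB Require Import structures.
From mathcomp Require Import all_boot all_order all_algebra.
From mathcomp Require Import reals.

Set Implicit Arguments.
Unset Strict Implicit.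
Unset Printing Implicit Defensive.

(* The vertex set is a subset of a fixed finite type T, so that a graph and all
   its subgraphs have the same type. *)
Record graph (T : finType) := Graph {
  verts : {set T};
  edges : {set {set T}};
  graph_wf : [forall e in edges, (e \subset verts) && (#|e| == 2)]
}.

Section Graphs.

Variable T : finType.
Implicit Types (G H K : graph T) (x y v : T) (c : seq T).

Definition adj G : rel T := fun x y => [set x; y] \in edges G.

Definition subgraph H G : bool :=
  (verts H \subset verts G) && (edges H \subset edges G).

(* A one-vertex graph has no cut vertex because the empty graph counts as
   connected. The empty graph is not a block of a nonempty graph, since it is
   contained in the one-vertex subgraphs. *)
Definition connected_graph G : Prop :=
  {in verts G &, forall x y, connect (adj G) x y}.

Fact del_vertex_wf G v :
  [forall e in [set e in edges G | v \notin e],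
     (e \subset verts G :\ v) && (#|e| == 2)].
Proof.
apply/forall_inP => e; rewrite inE => /andP[eG ve].
by have /andP[eV ->] := forall_inP (graph_wf G) e eG; rewrite subsetD1 eV ve.
Qed.

Definition del_vertex G v : graph T := Graph (del_vertex_wf G v).

Definition no_cut_vertex G : Prop :=
  forall v, v \in verts G -> connected_graph (del_vertex G v).

Definition is_block G H : Prop :=
  [/\ subgraph H G, connected_graph H, no_cut_vertex H &
      forall K, subgraph K G -> connected_graph K -> no_cut_vertex K ->
        subgraph H K -> K = H].

Definition complete_graph G : Prop :=
  {in verts G &, forall x y, x != y -> adj G x y}.

Definition block_clique G : Prop :=
  forall H, is_block G H -> complete_graph H.

Definition cycle_edges c : {set {set T}} := [set [set x; next c x] | x in c].

Definition chord G c x y : Prop :=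
  [/\ x \in c, y \in c, adj G x y & [set x; y] \notin cycle_edges c].

Definition chordal G : Prop :=
  forall c, ucycle (adj G) c -> 3 < size c -> exists x y, chord G c x y.

End Graphs.

(* None marks an unspecified entry. *)
Definition partial_matrix (R : Type) (n : nat) := 'M[option R]_n.

(* Meaningful when (i,j) and (j,i) are specified together: see adj_spec_graph. *)
Definition spec_edges (R : Type) (n : nat) (M : partial_matrix R n) :
    {set {set 'I_n}} :=
  [set [set p.1; p.2] | p : 'I_n * 'I_n & (p.1 != p.2) && isSome (M p.1 p.2)].

Fact spec_graph_wf (R : Type) (n : nat) (M : partial_matrix R n) :
  [forall e in spec_edges M, (e \subset [set: 'I_n]) && (#|e| == 2)].
Proof.
apply/forall_inP => _ /imsetP[[i j]] /[!inE] /= /andP[ij _] ->.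
by rewrite subsetT cards2 ij.
Qed.

Definition spec_graph (R : Type) (n : nat) (M : partial_matrix R n) :
  graph 'I_n := Graph (spec_graph_wf M).

Lemma adj_spec_graph (R : Type) (n : nat) (M : partial_matrix R n) (i j : 'I_n) :
  (M^T)%R = M -> adj (spec_graph M) i j = (i != j) && isSome (M i j).
Proof.
move=> symM; rewrite /adj /=; apply/imsetP/idP => [[[k l]]|ij]; last first.
  by exists (i, j); rewrite ?inE.
rewrite inE /= => /andP[kl Mkl] /setP E.
have Mlk : isSome (M l k) by rewrite -symM mxE.
have:= E i; have:= E j; have:= E k; have:= E l; rewrite !inE !eqxx /= ?orbT.
by case: (eqVneq i k) (eqVneq i l) (eqVneq j k) (eqVneq j l)
  => [?|_] [?|_] [?|_] [?|_] //=; subst; rewrite ?eqxx ?orbF // in kl *;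
  rewrite ?kl ?Mkl ?Mlk // eq_sym kl.
Qed.

Section Arrowhead.

Local Open Scope ring_scope.

Variables (R : Type) (S n1 n2 : nat).
Variables (X : 'M[R]_n1) (Y : 'I_S -> 'M[R]_n2) (Z : 'I_S -> 'M[R]_(n2, n1)).

Definition specified (m n : nat) (A : 'M[R]_(m, n)) : 'M[option R]_(m, n) :=
  map_mx Some A.

Definition unspecified (m n : nat) : 'M[option R]_(m, n) := const_mx None.

Definition arrowhead : partial_matrix R (n1 + \sum_(i < S) n2) :=
  block_mx
    (specified X)                          (\mxrow_(j < S) specified (Z j)^T)
    (\mxcol_(i < S) specified (Z i))
      (\mxblock_(i < S, j < S)
         if i == j then specified (Y i) else unspecified n2 n2).

Lemma tr_arrowhead :
  X^T = X -> (forall i, (Y i)^T = Y i) -> arrowhead^T = arrowhead.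
Proof.
move=> symX symY; rewrite /arrowhead tr_block_mx tr_mxrow tr_mxcol tr_mxblock.
congr block_mx.
- by rewrite /specified map_trmx symX.
- by apply/eq_mxrow => i; rewrite /specified -map_trmx.
- by apply/eq_mxcol => i; rewrite /specified map_trmx trmxK.
- apply/eq_mxblock => i j; rewrite eq_sym; case: eqP => [->|_].
    by rewrite /specified map_trmx symY.
  by rewrite /unspecified trmx_const.
Qed.

End Arrowhead.

(* Main.v *)
(** An arrowhead graph is described by a labelling of its vertices: the rows of
    [X] are hubs (label [None]) and the rows of [Y i] carry the label [Some i];
    distinct vertices are adjacent unless they carry different [Some]-labels.
    - On a cycle [a, x, b, d, ...] with at least four vertices, [x d] is a chord
      if [x] is a hub, and [a b] is a chord otherwise, since a neighbour of a
      vertex labelled [Some i] is a hub or is itself labelled [Some i].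
    - Off the hubs, labels are constant along paths. With at most one hub, a
      block therefore meets at most one [Some]-label (delete the hub if it lies
      in the block), so its vertices form a clique, and by maximality the block
      is the complete graph on them.
    - With two hubs, deleting a vertex leaves a hub adjacent to everything, so
      the whole graph is a block; it is not complete. *)
Require Import Defs.
From HB Require Import structures.
From mathcomp Require Import all_boot all_order all_algebra.
From mathcomp Require Import reals.

Set Implicit Arguments.
Unset Strict Implicit.
Unset Printing Implicit Defensive.

Section GraphTheory.

Variable T : finType.
Implicit Types (G H K : graph T) (x y v h : T).

Lemma adjC G x y : adj G x y = adj G y x.
Proof. by rewrite /adj setUC. Qed.

Lemma adj_verts G x y : adj G x y -> (x \in verts G) && (y \in verts G).
Proof.
move=> /(forall_inP (graph_wf G))/andP[/subsetP sub _].
by rewrite !sub // !inE eqxx ?orbT.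
Qed.

Lemma adj_neq G x y : adj G x y -> x != y.
Proof.
by move=> xy; apply: contraTneq (forall_inP (graph_wf G) _ xy) => ->; rewrite setUid cards1 andbF.
Qed.

Lemma graph_inj G H : verts G = verts H -> edges G = edges H -> G = H.
Proof.
case: G H => [V E wf] [V' E' wf'] /= eV eE; case: _ / eV wf'; case: _ / eE => wf'.
by rewrite (bool_irrelevance wf wf').
Qed.

Lemma subgraph_anti G H : subgraph G H -> subgraph H G -> G = H.
Proof.
move=> /andP[V1 E1] /andP[V2 E2].
by apply: graph_inj; apply/eqP; rewrite eqEsubset ?V1 ?V2 ?E1 ?E2.
Qed.

Lemma subgraph_adj H G x y : subgraph H G -> adj H x y -> adj G x y.
Proof. by move=> /andP[_ /subsetP]; apply. Qed.

Lemma adj_del_vertex G v x y :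
  adj (del_vertex G v) x y = [&& adj G x y, v != x & v != y].
Proof. by rewrite /adj !inE negb_or. Qed.

Lemma connected_graph_dominating G h :
  {in verts G, forall x, x != h -> adj G h x} -> connected_graph G.
Proof.
move=> hub x y xG yG; apply: (@connect_trans _ _ h).
  by case: (eqVneq x h) => [->//|xh]; rewrite connect1 // adjC hub.
by case: (eqVneq y h) => [->//|yh]; rewrite connect1 // hub.
Qed.

Lemma complete_graph_connected G : complete_graph G -> connected_graph G.
Proof.
move=> cG x y xG yG; case: (eqVneq x y) => [->//|xy].
by rewrite connect1 // cG.
Qed.

Lemma complete_del_vertex G v : complete_graph G -> complete_graph (del_vertex G v).
Proof.
move=> cG x y; rewrite !inE => /andP[xv xG] /andP[yv yG] xy.
by rewrite adj_del_vertex cG // ![v == _]eq_sym xv.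
Qed.

Fact induced_wf G (A : {set T}) :
  [forall e in [set e in edges G | e \subset A], (e \subset A) && (#|e| == 2)].
Proof.
apply/forall_inP => e; rewrite inE => /andP[eG ->].
by have /andP[] := forall_inP (graph_wf G) e eG.
Qed.

Definition induced G (A : {set T}) : graph T := Graph (induced_wf G A).

Lemma adj_induced G (A : {set T}) x y :
  adj (induced G A) x y = [&& adj G x y, x \in A & y \in A].
Proof. by rewrite /adj inE subUset !sub1set. Qed.

(** The subgraph of [G] induced on [verts H] is complete, hence connected without cut vertex, and it
    contains [H]; maximality of the block identifies the two. *)
Lemma block_complete G H : is_block G H ->
  {in verts H &, forall x y, x != y -> adj G x y} -> complete_graph H.
Proof.
move=> [HG _ _ maxH] cliqueH.
have cK : complete_graph (induced G (verts H)).
  by move=> x y xH yH xy; rewrite adj_induced cliqueH // xH yH.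
have KG : subgraph (induced G (verts H)) G.
  have /andP[VHG _] := HG; rewrite /subgraph VHG.
  by apply/subsetP => e; rewrite inE => /andP[].
have HK : subgraph H (induced G (verts H)).
  have /andP[_ /subsetP EHG] := HG; rewrite /subgraph subxx.
  apply/subsetP => e eH; rewrite inE EHG //=.
  by have /andP[] := forall_inP (graph_wf H) e eH.
rewrite -(maxH _ KG (complete_graph_connected cK) _ HK) // => v _.
exact/complete_graph_connected/complete_del_vertex.
Qed.

(** A cycle edge joins some [z] to its successor, so it can equal the pair [x], [y] only if one of
    these succeeds the other. *)
Lemma chord_not_next G (c : seq T) x y :
  x \in c -> y \in c -> adj G x y -> next c x != y -> next c y != x ->
  chord G c x y.
Proof.
move=> xc yc xy nx ny; split=> //; apply/imsetP => -[z _ E].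
have neq_xy := adj_neq xy.
have xE : x \in [set z; next c z] by rewrite -E set21.
have yE : y \in [set z; next c z] by rewrite -E set22.
case/set2P: xE yE => [<-|xz] /set2P[] yz.
- by rewrite yz eqxx in neq_xy.
- by rewrite -yz eqxx in nx.
- by rewrite yz -xz eqxx in ny.
- by rewrite xz yz eqxx in neq_xy.
Qed.

End GraphTheory.

Section ArrowheadGraph.

Variables (T : finType) (I : eqType) (G : graph T) (l : T -> option I).
Hypothesis vertsG : verts G = [set: T].
Hypothesis adjG : forall x y,
  adj G x y = (x != y) && [|| l x == None, l y == None | l x == l y].

Lemma arrowhead_chordal : chordal G.
Proof.
case=> [|a [|x [|b [|d s]]]] // /andP[/= /and4P[ax xb bd pd]].
rewrite !inE !negb_or.
move=> /and4P[/and4P[nax nab nad nas] /and3P[nxb nxd nxs] /andP[nbd nbs] _] _.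
have [lx|lx] := eqVneq (l x) None.
  exists x, d; apply: chord_not_next;
    rewrite ?inE ?eqxx ?orbT ?adjG ?nxd ?lx //=.
  - by rewrite [x == a]eq_sym (negPf nax) eqxx.
  - rewrite ![d == _]eq_sym (negPf nad) (negPf nxd) (negPf nbd).
    (* The successor of [d] is [a] if the cycle closes here, and the head of [s] otherwise. *)
    case: s nxs {pd nas nbs} => [|e s] /=; rewrite eqxx //.
    by rewrite inE negb_or eq_sym => /andP[].
exists a, b; apply: chord_not_next;
  rewrite ?inE ?eqxx ?orbT ?adjG ?nab //=.
- move: ax xb; rewrite !adjG nax nxb (negPf lx) /=.
  by case/predU1P => [->//|/eqP->]; case/predU1P => [->|/eqP->]; rewrite eqxx ?orbT.
- by rewrite eqxx.
- by rewrite ![b == _]eq_sym (negPf nab) (negPf nxb) eqxx eq_sym.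
Qed.

Lemma label_connect (e : rel T) x y :
    (forall u v, e u v -> l u = l v) -> connect e x y -> l x = l y.
Proof.
move=> le /connectP[p]; elim: p x => [|z p IH] x /=; first by move=> _ ->.
by move=> /andP[/le-> /IH]; apply.
Qed.

Lemma arrowhead_block_clique :
  (forall x y, l x = None -> l y = None -> x = y) -> block_clique G.
Proof.
move=> hub1 H blkH; apply: (block_complete blkH) => x y xH yH xy.
have [HG conH cutH _] := blkH.
(* Used twice below: for [del_vertex H h] if the block has a hub [h], and for [H] itself if it has
   none. *)
have lK K : subgraph K G -> {in verts K, forall z, l z != None} ->
    forall u v, adj K u v -> l u = l v.
  move=> KG lK u v uv; have /andP[uK vK] := adj_verts uv.
  move: (subgraph_adj KG uv); rewrite adjG.
  by rewrite (negPf (lK _ uK)) (negPf (lK _ vK)) /= => /andP[_ /eqP].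
rewrite adjG xy /=.
have [//|lx] := eqVneq (l x) None; have [//|ly] /= := eqVneq (l y) None.
have [h /andP[hH /eqP lh]|nohub] := pickP [pred h in verts H | l h == None].
  have DG : subgraph (del_vertex H h) G.
    have /andP[VH EH] := HG.
    rewrite /subgraph (subset_trans (subD1set _ _)) //=.
    by apply: subset_trans EH; apply/subsetP => e; rewrite inE => /andP[].
  apply/eqP; apply: (label_connect (lK _ DG _)).
    move=> z; rewrite !inE => /andP[zh _].
    by apply: contra zh => /eqP lz; rewrite (hub1 _ _ lz lh).
  by apply: (cutH h hH); rewrite !inE ?xH ?yH andbT;
    [apply: contra lx | apply: contra ly] => /eqP->; rewrite lh.
apply/eqP; apply: (label_connect (lK _ HG _)); last exact: conH.
by move=> z zH; have /= := nohub z; rewrite zH /= => ->.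
Qed.

(** The vertices [x] and [y] are the non-adjacent pair that refutes completeness of the block
    [G]. *)
Lemma arrowhead_not_block_clique h1 h2 x y :
  h1 != h2 -> l h1 = None -> l h2 = None ->
  l x != None -> l y != None -> l x != l y -> ~ block_clique G.
Proof.
move=> h12 lh1 lh2 lx ly lxy /(_ G) blkG.
have xy : x != y by apply: contraNneq lxy => ->.
suff /blkG /(_ x y) : is_block G G.
  by rewrite vertsG !inE adjG (negPf lx) (negPf ly) (negPf lxy) andbF => /(_ isT isT xy).
split.
- by rewrite /subgraph !subxx.
- apply: (@connected_graph_dominating _ _ h1) => z _ zh.
  by rewrite adjG lh1 eq_sym zh.
- move=> v _.
  (* One of the two hubs survives the deletion of [v]. *)
  have [h lh vh] : exists2 h, l h = None & v != h.
    by case: (eqVneq v h1) => [->|vh]; [exists h2 | exists h1].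
  apply: (@connected_graph_dominating _ _ h) => z; rewrite !inE => /andP[zv _] zh.
  by rewrite adj_del_vertex adjG lh vh [h == z]eq_sym zh [v == z]eq_sym zv.
- by move=> K KG _ _ GK; apply: subgraph_anti.
Qed.

End ArrowheadGraph.

Section ArrowheadLabels.

Variables S n1 n2 : nat.

(** [tagnat.sig1 k] is the index of the diagonal block through which row [k] of the lower part
    passes. *)
Definition arrowhead_label (i : 'I_(n1 + \sum_(i < S) n2)) : option 'I_S :=
  match split i with inl _ => None | inr k => Some (tagnat.sig1 k) end.

Lemma arrowhead_label_lshift i : arrowhead_label (lshift _ i) = None.
Proof. by rewrite /arrowhead_label (unsplitK (inl i)). Qed.

Lemma arrowhead_label_rshift k : arrowhead_label (rshift _ k) = Some (tagnat.sig1 k).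
Proof. by rewrite /arrowhead_label (unsplitK (inr k)). Qed.

Lemma isSome_arrowhead (R : Type) (X : 'M[R]_n1) (Y : 'I_S -> 'M[R]_n2)
    (Z : 'I_S -> 'M[R]_(n2, n1)) i j :
  let l := arrowhead_label in
  isSome (arrowhead X Y Z i j) = [|| l i == None, l j == None | l i == l j].
Proof.
rewrite /= /arrowhead; case: (split_ordP i) => {}i ->; case: (split_ordP j) => {}j ->;
  rewrite ?arrowhead_label_lshift ?arrowhead_label_rshift
          ?(block_mxEul, block_mxEur, block_mxEdl, block_mxEdr) !mxE //=.
(* Equality of [Some]-labels unfolds to the test on block indices that selects [specified] or
   [unspecified] in [arrowhead]. *)
by rewrite [RHS]/(tagnat.sig1 i == tagnat.sig1 j); case: ifP; rewrite !mxE.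
Qed.

End ArrowheadLabels.

Theorem lemma4 (R : realType) (S n1 n2 : nat) (X : 'M[R]_n1)
    (Y : 'I_S -> 'M[R]_n2) (Z : 'I_S -> 'M[R]_(n2, n1)) :
  1 < S -> 1 <= n2 ->
  (X^T)%R = X -> (forall i : 'I_S, ((Y i)^T)%R = Y i) ->
  let Gspec := spec_graph (arrowhead X Y Z) in
  [/\ chordal Gspec,
      n1 = 0 \/ n1 = 1 -> block_clique Gspec &
      2 <= n1 -> ~ block_clique Gspec].
Proof.
move=> S_gt1 n2_gt0 symX symY Gspec.
(* Unification fills the hole with the label condition, which gives the shape assumed of an abstract
   arrowhead graph. *)
have adjG x y : adj Gspec x y = (x != y) && _ :=
  etrans (adj_spec_graph _ _ (tr_arrowhead Z symX symY))
         (congr1 (andb _) (isSome_arrowhead X Y Z x y)).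
split.
- exact: arrowhead_chordal adjG.
- move=> n1_le1; apply: (arrowhead_block_clique adjG) => x y.
  case: (split_ordP x) => {}x ->; rewrite ?arrowhead_label_rshift // => _.
  case: (split_ordP y) => {}y ->; rewrite ?arrowhead_label_rshift // => _.
  congr lshift; apply: val_inj => /=.
  (* Passing to bare naturals below [n1] lets [n1] be replaced by 0 or 1 without dependent types. *)
  move: (val x) (val y) (ltn_ord x) (ltn_ord y) => i j.
  by case: n1_le1 => ->; case: i j => [|i] [|j].
- move=> n1_gt1.
  (* [hub k] is row [k] of [X] and [leaf k] is the first row of the block [Y k], for [k] equal to 0
     or 1. *)
  pose hub k (lt_k : k < 2) := lshift (\sum_(i < S) n2) (Ordinal (leq_trans lt_k n1_gt1)).
  pose leaf k (lt_k : k < 2) :=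
    rshift n1 (tagnat.Rank (n := S) (p_ := fun=> n2) (Ordinal (leq_trans lt_k S_gt1)) (Ordinal n2_gt0)).
  apply: (@arrowhead_not_block_clique _ _ _ _ _ adjG
            (hub 0 isT) (hub 1 isT) (leaf 0 isT) (leaf 1 isT));
    by rewrite ?arrowhead_label_lshift ?arrowhead_label_rshift ?tagnat.Rank1K.
Qed.
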